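(* Let $Y$ be an infinite-dimensional Banach space which is not finitely squarable. Then $Y$ does not have the Lebesgue-Bochner discretization property.
   Context: An infinite-dimensional Banach space $Y$ is called finitely squarable if there exists a constant $C$ such that for every finite-dimensional subspace $Z\subset Y$ the direct sum $Z\oplus_\infty Z$ (with norm $\|(z_1,z_2)\|=\max\{\|z_1\|,\|z_2\|\}$) admits a linear embedding into $Y$ with distortion bounded by $C$, i.e. an injective linear map $S:Z\oplus_\infty Z\to Y$ with $\|S\|\,\|S^{-1}|_{\mathrm{im}\,S}\|\le C$. For a probability measure $\mu$ and a Banach space $Z$, $L_p(\mu,Z)$ is the Lebesgue-Bochner space of $Z$-valued functions. For $K\ge1$, a finite-dimensional normed space $W$ is called $K$-embeddable into $Y$ if the infimum of the distortions $\|S\|\,\|S^{-1}|_{S(W)}\|$ over all injective linear maps $S:W\to Y$ is at most $K$. A Banach space $Y$ has the Lebesgue-Bochner discretization property if for any separable probability measure $\mu$ there exists a function $f:[1,\infty)\to[1,\infty)$ such that for any $C\ge1$ and any finite-dimensional subspace $Z\subset Y$, if $W$ is any finite-dimensional subspace of $L_\infty(\mu,Z)$ such that $\|w\|_{L_\infty(\mu,Z)}\le C\|w\|_{L_1(\mu,Z)}$ for all $w\in W$, then $W$ (with the $L_\infty(\mu,Z)$ norm) is $f(C)$-embeddable into $Y$. *)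

(* Defs.v *)
From HB Require Import structures.
From mathcomp Require Import all_boot all_order all_algebra.
From mathcomp Require Import all_classical all_reals all_analysis.
From mathcomp Require Import measurable_realfun ess_sup_inf hoelder.
Set Implicit Arguments.
Unset Strict Implicit.
Unset Printing Implicit Defensive.
Import Order.TTheory GRing.Theory Num.Theory.
Import numFieldNormedType.Exports.
Local Open Scope classical_set_scope.
Local Open Scope ring_scope.

Section findim.
Context {R : realType} {E : lmodType R}.

Definition lspan n (e : 'I_n -> E) : set E :=
  [set x | exists a : 'I_n -> R, x = \sum_(i < n) a i *: e i].

Definition findim_subspace (W : set E) : Prop :=
  exists n (e : 'I_n -> E), W = lspan e.

End findim.

Definition infinite_dimensional (R : realType) (E : lmodType R) : Prop :=
  ~ findim_subspace [set: E].

Section distortion.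
Context {R : realType} {E F : normedModType R}.

(* A linear map defined on a subspace W of E is encoded by a function on E;
   only its values on W matter. *)
Definition linear_on (W : set E) (S : E -> F) : Prop :=
  forall a : R, {in W &, forall u v, S (a *: u + v) = a *: S u + S v}.

Definition lin_embedding (W : set E) (S : E -> F) : Prop :=
  linear_on W S /\ {in W &, injective S}.

End distortion.

Definition opnorm (R : realType) (E F : normedModType R)
    (W : set E) (S : E -> F) : \bar R :=
  ereal_sup [set (`|S x|)%:E | x in W `&` [set x | `|x| <= 1]].

(* 'pinv_(cst 0) W S restricts on S @` W to the inverse of S : W -> S @` W. *)
Definition distortion (R : realType) (E F : normedModType R)
    (W : set E) (S : E -> F) : \bar R :=
  (opnorm W S * opnorm (S @` W) ('pinv_(cst 0%R) W S))%E.

Definition embeddable (R : realType) (E Y : normedModType R)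
    (K : R) (W : set E) : Prop :=
  (ereal_inf [set distortion W S | S in [set S : E -> Y | lin_embedding W S]]
     <= K%:E)%E.
Arguments embeddable {R E} Y K W.

(* The norm of the product Y * Y is the maximum norm, so that
   Z `*` Z is the sum of two copies of Z with the maximum norm. *)
Definition finitely_squarable (R : realType) (Y : normedModType R) : Prop :=
  exists C : R, forall Z : set Y, findim_subspace Z ->
    exists2 S : Y * Y -> Y,
      lin_embedding (Z `*` Z) S & (distortion (Z `*` Z) S <= C%:E)%E.

(* Separability of the measure algebra with distance mu (A `+` B). *)
Definition separable_measure d (T : measurableType d) (R : realType)
    (mu : {measure set T -> \bar R}) : Prop :=
  exists A : nat -> set T, (forall n, measurable (A n)) /\
    forall B, measurable B -> forall eps : R, 0 < eps ->
      exists n, (mu (A n `+` B) < eps%:E)%E.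

Section bochner.
Context {d} {T : measurableType d} {R : realType}.
Variables (mu : probability T R) (E : normedModType R).

Definition simple_function (s : T -> E) : Prop :=
  finite_set (range s) /\ forall y, measurable (s @^-1` [set y]).

(* The limit is required everywhere and not only almost everywhere: up to
   almost everywhere equality this gives the same functions. *)
Definition strongly_measurable (f : T -> E) : Prop :=
  exists s : nat -> T -> E, (forall n, simple_function (s n)) /\
    forall x, s n x @[n --> \oo] --> f x.

Definition Bnorm (p : \bar R) (f : T -> E) : \bar R :=
  ('N[mu]_p[EFin \o (Num.norm \o f)])%E.

Definition Linfty_fun : {pred T -> E} :=
  mem [set f | strongly_measurable f /\ (Bnorm +oo f < +oo)%E].

Lemma simple_function_cst (c : E) : simple_function (cst c).
Proof.
split.
  apply: (@sub_finite_set _ _ [set c]) => [_ [x _ <-]//|]; exact: finite_set1.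
move=> y; have [->|yc] := pselect (c = y).
  by rewrite (_ : _ @^-1` _ = setT) //; apply/seteqP; split.
by rewrite (_ : _ @^-1` _ = set0) //; apply/seteqP; split.
Qed.

Lemma simple_function_comp2 (h : E -> E -> E) (s t : T -> E) :
  simple_function s -> simple_function t ->
  simple_function (fun x => h (s x) (t x)).
Proof.
move=> [fs ms] [ft mt]; split.
  apply: (@sub_finite_set _ _ [set h x y | x in range s & y in range t]).
    by move=> _ [x _ <-]; exists (s x); [exists x|exists (t x) => //; exists x].
  exact: finite_image2.
move=> y.
rewrite (_ : _ @^-1` _ = \bigcup_(p in range s `*` range t)
   ((s @^-1` [set p.1] `&` t @^-1` [set p.2]) `&` [set _ | h p.1 p.2 = y])).
  apply: fin_bigcup_measurable; first exact: finite_setX.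
  move=> p _; have [e|ne] := pselect (h p.1 p.2 = y).
    rewrite (_ : [set _ | _] = setT) ?setIT; first exact: measurableI.
    by apply/seteqP; split.
  rewrite (_ : [set _ | _] = set0) ?setI0; first exact: measurable0.
  by apply/seteqP; split.
apply/seteqP; split=> [x /= e|x [p _ /= [[-> ->]]]//].
by exists (s x, t x) => //; split; exists x.
Qed.

Lemma simple_function_norm (s : T -> E) :
  simple_function s -> measurable_fun [set: T] (Num.norm \o s).
Proof.
move=> [fs ms] _ B mB; rewrite setTI.
rewrite (_ : _ @^-1` _ =
    \bigcup_(y in range s `&` [set y | B `|y|]) (s @^-1` [set y])).
  by apply: fin_bigcup_measurable => //; exact: finite_setIl.
apply/seteqP; split => [x /= Bx|x [y [_ /= By] /= ->]//].
by exists (s x) => //; split => //; exists x.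
Qed.

Lemma strongly_measurable_norm (f : T -> E) :
  strongly_measurable f -> measurable_fun [set: T] (Num.norm \o f).
Proof.
move=> [s [ss sf]]; apply: (measurable_fun_cvg (h := fun n => Num.norm \o s n)).
  by move=> n; exact: simple_function_norm.
by move=> x _; apply: cvg_norm; exact: sf.
Qed.

Lemma strongly_measurable_lin (a : R) (f g : T -> E) :
  strongly_measurable f -> strongly_measurable g ->
  strongly_measurable (a *: f + g).
Proof.
move=> [s [ss sf]] [t [st tg]].
exists (fun n x => a *: s n x + t n x); split.
  by move=> n; apply: (simple_function_comp2 (fun u v => a *: u + v)).
by move=> x; apply: cvgD => //; apply: cvgZr.
Qed.

Let mu_gt0 : (0 < mu [set: T])%E.
Proof. by rewrite probability_setT lte01. Qed.

Lemma Bnorm_infty f :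
  Bnorm +oo f = ess_sup mu (EFin \o (Num.norm \o f)).
Proof.
rewrite /Bnorm unlock mu_gt0; congr ess_sup.
by apply/funext => x /=; rewrite normr_id.
Qed.

Lemma Bnorm_ge0 p f : (0 <= Bnorm p f)%E.
Proof. exact: Lnorm_ge0. Qed.

Lemma Bnorm_infty_cst0 : Bnorm +oo (0 : T -> E) = 0%E.
Proof.
rewrite Bnorm_infty; apply: ess_sup_ae_cst => //; apply/nearW => x /=.
by rewrite -[X in Num.norm X]/(0 : E) normr0.
Qed.

Lemma Bnorm_inftyD f g :
  (Bnorm +oo (f + g)%R <= Bnorm +oo f + Bnorm +oo g)%E.
Proof.
rewrite !Bnorm_infty; apply: le_trans (ess_supD _ _ _); apply: le_ess_sup.
by apply/nearW => x /=; rewrite -EFinD lee_fin ler_normD.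
Qed.

Lemma Bnorm_inftyZ (a : R) f :
  Bnorm +oo (a *: f) = (`|a|%:E * Bnorm +oo f)%E.
Proof.
rewrite !Bnorm_infty -ess_supZl//; congr ess_sup.
by apply/funext => x /=; rewrite -EFinM normrZ.
Qed.

Lemma Linfty_submod_closed : submod_closed Linfty_fun.
Proof.
split; first by rewrite !inE; split;
  [exists (fun _ => cst 0); split => [n|x];
    [exact: simple_function_cst|exact: cvg_cst]
  |rewrite Bnorm_infty_cst0 ltry].
move=> a f g; rewrite !inE => -[mf ff] [mg fg]; split.
  exact: strongly_measurable_lin.
apply: (le_lt_trans (Bnorm_inftyD _ _)); rewrite Bnorm_inftyZ.
by rewrite lte_add_pinfty// lte_mul_pinfty// lee_fin.
Qed.

HB.instance Definition _ :=
  GRing.isSubmodClosed.Build R (T -> E) Linfty_fun Linfty_submod_closed.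

Record LinftyFun := MkLinftyFun {
  Linfty_val :> T -> E; Linfty_valP : Linfty_val \in Linfty_fun }.

HB.instance Definition _ := [isSub for Linfty_val].
HB.instance Definition _ := [Choice of LinftyFun by <:].
HB.instance Definition _ := [SubChoice_isSubLmodule of LinftyFun by <:].

Definition Linfty_null : {pred LinftyFun} :=
  mem [set f : LinftyFun | \forall x \ae mu, f x = 0].

Lemma Linfty_null_submod_closed : submod_closed Linfty_null.
Proof.
split; first by rewrite inE; apply/nearW => x.
move=> a f g; rewrite !inE => f0 g0; near=> x.
change (a *: f x + g x = 0).
by rewrite (near f0 x)// (near g0 x)// scaler0 addr0.
Unshelve. all: by end_near. Qed.

HB.instance Definition _ := GRing.isSubmodClosed.Build R LinftyFun Linfty_null
  Linfty_null_submod_closed.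


Local Open Scope quotient_scope.

Definition Linfty := Quotient.quot Linfty_null.

HB.instance Definition _ := GRing.Zmodule.on Linfty.
HB.instance Definition _ := EqQuotient.on Linfty.

Definition Linfty_class (f : LinftyFun) : Linfty := \pi_Linfty f.

Lemma Linfty_classW (P : Linfty -> Prop) :
  (forall f, P (Linfty_class f)) -> forall w, P w.
Proof. by move=> Pf w; rewrite -[w]reprK; exact: Pf. Qed.

Lemma Linfty_eqP (f g : LinftyFun) :
  Linfty_class f = Linfty_class g <-> \forall x \ae mu, f x = g x.
Proof.
rewrite /Linfty_class (rwP eqP) -(@Quotient.idealrBE _ Linfty_null) inE; split => h.
  by near=> x; apply/eqP; rewrite -subr_eq0; apply/eqP; exact: (near h x).
by near=> x; change (f x - g x = 0); rewrite (near h x)// subrr.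
Unshelve. all: by end_near. Qed.

Lemma Linfty_reprP (f : LinftyFun) :
  \forall x \ae mu, repr (Linfty_class f) x = f x.
Proof. by apply/Linfty_eqP; exact: reprK. Qed.

Lemma Linfty_piD f g : Linfty_class (f + g) = Linfty_class f + Linfty_class g.
Proof. exact: (raddfD \pi_(Quotient.quot Linfty_null)). Qed.

Definition Linfty_scale (a : R) (w : Linfty) : Linfty :=
  Linfty_class (a *: repr w).

Lemma Linfty_piZ a (f : LinftyFun) :
  Linfty_class (a *: f) = Linfty_scale a (Linfty_class f).
Proof.
apply/Linfty_eqP; near=> x; change (a *: f x = a *: repr (Linfty_class f) x).
by congr (_ *: _); apply/esym; near: x; exact: Linfty_reprP.
Unshelve. all: by end_near. Qed.

Let scaleA a b v : Linfty_scale a (Linfty_scale b v) = Linfty_scale (a * b) v.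
Proof. by elim/Linfty_classW: v => f; rewrite -!Linfty_piZ scalerA. Qed.

Let scale1 : left_id 1 Linfty_scale.
Proof. by elim/Linfty_classW => f; rewrite -Linfty_piZ scale1r. Qed.

Let scaleDr : right_distributive Linfty_scale +%R.
Proof.
move=> a; elim/Linfty_classW => f; elim/Linfty_classW => g.
by rewrite -Linfty_piD -3!Linfty_piZ scalerDr Linfty_piD.
Qed.

Let scaleDl v : {morph Linfty_scale^~ v : a b / a + b}.
Proof. by elim/Linfty_classW: v => f a b; rewrite -!Linfty_piZ scalerDl Linfty_piD. Qed.

HB.instance Definition _ := GRing.Zmodule_isLmodule.Build R Linfty
  scaleA scale1 scaleDr scaleDl.

Definition Linfty_norm (w : Linfty) : R := fine (Bnorm +oo (repr w)).

Lemma Bnorm_fin_num (f : LinftyFun) : Bnorm +oo f \is a fin_num.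
Proof.
have := Linfty_valP f; rewrite inE => -[_ foo].
by rewrite ge0_fin_numE// Bnorm_ge0.
Qed.

Lemma eq_ae_Bnorm_infty (f g : T -> E) :
  (\forall x \ae mu, f x = g x) -> Bnorm +oo f = Bnorm +oo g.
Proof.
move=> fg; rewrite !Bnorm_infty; apply: eq_ess_sup.
by apply: filterS fg => x /= ->.
Qed.

Lemma Linfty_normE (f : LinftyFun) :
  Linfty_norm (Linfty_class f) = fine (Bnorm +oo f).
Proof. by congr fine; apply: eq_ae_Bnorm_infty; exact: Linfty_reprP. Qed.

Let normD (u v : Linfty) :
  Linfty_norm (u + v) <= Linfty_norm u + Linfty_norm v.
Proof.
elim/Linfty_classW: u => f; elim/Linfty_classW: v => g; rewrite -Linfty_piD !Linfty_normE.
rewrite -fineD ?Bnorm_fin_num// fine_le ?fin_numD ?Bnorm_fin_num//.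
exact: Bnorm_inftyD.
Qed.

Let normZ (a : R) (v : Linfty) : Linfty_norm (a *: v) = `|a| * Linfty_norm v.
Proof.
elim/Linfty_classW: v => f; rewrite -[_ *: _]Linfty_piZ !Linfty_normE.
rewrite [X in fine X](Bnorm_inftyZ a f).
by rewrite fineM ?Bnorm_fin_num.
Qed.

Let norm0 (v : Linfty) : Linfty_norm v = 0 -> v = 0.
Proof.
elim/Linfty_classW: v => f; rewrite Linfty_normE => /eqP; rewrite fine_eq0 ?Bnorm_fin_num// => /eqP.
rewrite Bnorm_infty => h.
transitivity (Linfty_class 0); last exact: (raddf0 \pi_(Quotient.quot Linfty_null)).
apply/Linfty_eqP; have := ess_sup_ge mu (EFin \o (Num.norm \o f)).
rewrite h; apply: filterS => x /=; rewrite lee_fin normr_le0 => /eqP ->.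
by [].
Qed.

HB.instance Definition _ := Lmodule_isNormed.Build R Linfty normD normZ norm0.

End bochner.

(* L_oo(mu, Z) for a subspace Z of E, as a subset of L_oo(mu, E). A Z-valued
   function is a limit of simple functions in Z iff it is one in E. *)
Definition Linfty_in d (T : measurableType d) (R : realType)
    (mu : probability T R) (E : normedModType R) (Z : set E) :
    set (Linfty mu E) :=
  [set w | exists2 f : LinftyFun mu E, w = Linfty_class f & forall x, Z (f x)].

Definition L1norm d (T : measurableType d) (R : realType)
    (mu : probability T R) (E : normedModType R) (w : Linfty mu E) : \bar R :=
  Bnorm mu 1 (repr w).

(* The value of L1norm does not depend on the representative. *)
Lemma L1normE d (T : measurableType d) (R : realType) (mu : probability T R)
    (E : normedModType R) (f : LinftyFun mu E) :
  L1norm (Linfty_class f) = (\int[mu]_x (`|f x|)%:E)%E.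
Proof.
rewrite /L1norm /Bnorm Lnorm1.
have mf (g : LinftyFun mu E) : measurable_fun [set: T] (EFin \o (Num.norm \o g)).
  apply/measurable_EFinP/strongly_measurable_norm.
  by have := Linfty_valP g; rewrite inE => -[].
under eq_integral => x _ do rewrite /= normr_id.
apply: ae_eq_integral => //; [exact: mf..|].
by apply: filterS (Linfty_reprP f) => x /= -> _.
Qed.

Definition LB_discretization (R : realType) (Y : normedModType R) : Prop :=
  forall (d : measure_display) (T : measurableType d) (mu : probability T R),
    separable_measure mu ->
  exists f : R -> R, (forall C, 1 <= C -> 1 <= f C) /\
    forall C, 1 <= C ->
    forall Z : set Y, findim_subspace Z ->
    forall W : set (Linfty mu Y), findim_subspace W -> W `<=` Linfty_in Z ->
      (forall w, W w -> ((`|w|)%:E <= C%:E * L1norm w)%E) ->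
    embeddable Y (f C) W.

(* Main.v *)
From HB Require Import structures.
Require Import Defs.
From mathcomp Require Import all_boot all_order all_algebra.
From mathcomp Require Import all_classical all_reals all_analysis.
From mathcomp Require Import ess_sup_inf.
Set Implicit Arguments.
Unset Strict Implicit.
Unset Printing Implicit Defensive.
Import Order.TTheory GRing.Theory Num.Theory.
Import numFieldNormedType.Exports.
Local Open Scope classical_set_scope.
Local Open Scope ring_scope.

(** For the uniform probability on two points, [L_oo(mu, Z)] is isometric to
    [Z (+)_oo Z] and its norm is at most twice the [L_1] norm.  Hence the
    discretization property, applied with [C = 2] to [W = L_oo(mu, Z)], embeds
    [Z (+)_oo Z] into [Y] with distortion at most [f 2 + 1]. *)

Lemma findim_subspace_image (R : realType) (E F : lmodType R)
    (J : {linear E -> F}) (V : set E) :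
  findim_subspace V -> findim_subspace (J @` V).
Proof.
move=> [n [e ->]]; exists n, (J \o e); apply/seteqP; split.
  move=> _ [_ [a ->] <-]; exists a; rewrite linear_sum.
  by apply: eq_bigr => i _; rewrite linearZ.
move=> _ [a ->]; exists (\sum_(i < n) a i *: e i); first by exists a.
by rewrite linear_sum; apply: eq_bigr => i _; rewrite linearZ.
Qed.

Lemma findim_subspace_setX (R : realType) (E F : lmodType R)
    (V : set E) (W : set F) :
  findim_subspace V -> findim_subspace W -> findim_subspace (V `*` W).
Proof.
move=> [m [e ->]] [n [f ->]].
exists (m + n)%N, (fun i => match fintype.split i with
  inl j => (e j, 0) | inr k => (0, f k) end).
(* The family concatenates [(e j, 0)] and [(0, f k)]. Its combinations split into two independent
   coordinates, and both inclusions follow from this identity. *)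
have sumE (a : 'I_(m + n) -> R) :
    \sum_i a i *: match fintype.split i with inl j => (e j, 0) | inr k => (0, f k) end =
    (\sum_j a (lshift n j) *: e j, \sum_k a (rshift m k) *: f k).
  rewrite big_split_ord/=.
  under eq_bigr do rewrite (unsplitK (inl _)).
  under [X in _ + X]eq_bigr do rewrite (unsplitK (inr _)).
  rewrite [LHS]surjective_pairing !raddfD/= !raddf_sum/=.
  rewrite [X in (_ + X, _)]big1 ?[X in (_, X + _)]big1 ?addr0 ?add0r//;
    by move=> i _; rewrite scaler0.
apply/seteqP; split.
  move=> [x y] [/= [a ->] [b ->]].
  exists (fun i => match fintype.split i with inl j => a j | inr k => b k end).
  rewrite sumE; congr pair; apply: eq_bigr => i _.
    by rewrite (unsplitK (inl _)).
  by rewrite (unsplitK (inr _)).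
by move=> _ [a ->]; rewrite sumE; split; [exists (a \o @lshift m n)|exists (a \o @rshift m n)].
Qed.

Lemma distortion_comp_isometry (R : realType) (E F G : normedModType R)
    (J : E -> F) (S : F -> G) (V : set E) :
  injective J -> (forall x, `|J x| = `|x|) -> {in J @` V &, injective S} ->
  distortion V (S \o J) = distortion (J @` V) S.
Proof.
move=> injJ normJ injS.
have injSJ : {in V &, injective (S \o J)}.
  move=> x y; rewrite !inE => Vx Vy /= eS; apply/injJ/injS => //; rewrite inE.
    by exists x.
  by exists y.
rewrite /distortion; congr (_ * _)%E.
  rewrite /opnorm; congr ereal_sup; apply/seteqP; split.
    move=> _ [x [Vx /= x1] <-]; exists (J x) => //.
    by split; [exists x|rewrite /= normJ].
  by move=> _ [_ [[x Vx <-] /= +] <-]; rewrite normJ => x1; exists x.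
rewrite /opnorm image_comp; congr ereal_sup; apply: eq_imagel.
move=> _ [[x Vx <-] _]; congr (_%:E).
(* At [S (J x)] the two pseudo-inverses return [x] and [J x]; injectivity on the respective domains
   makes them genuine inverses there. *)
rewrite (pinvKV _ injSJ) ?inE//= (pinvKV _ injS) ?normJ//.
by rewrite inE; exists x.
Qed.

Section two_points.
Context {R : realType}.

Definition fair_coin : probability bool R := bernoulli_prob 2^-1.

Let half01 : 0 <= (2^-1 : R) <= 1.
Proof. by rewrite invr_ge0 ler0n invf_le1// ler1n. Qed.

Let onem_half : 1 - 2^-1 = 2^-1 :> R.
Proof. by rewrite [X in X - _](splitr 1) mul1r addrK. Qed.

(** Each point has mass 1/2, so a null set contains no point. *)
Lemma fair_coin_ae (P : bool -> Prop) :
  (\forall b \ae fair_coin, P b) -> forall b, P b.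
Proof.
move=> [A [mA A0 PA]] b; apply: contrapT => nPb.
have Ab : A b by exact: PA.
have mub : (0 < fair_coin [set b])%E.
  rewrite /fair_coin/= bernoulli_probE//.
  by case: b {nPb Ab}; rewrite !diracE !classical_sets.in_set1 /unstable.onem onem_half
    -!EFinM -EFinD lte_fin/= !(mulr1, mulr0, addr0, add0r) invr_gt0.
have : (fair_coin [set b] <= fair_coin A)%E.
  by apply: le_measure; rewrite ?inE// => _ ->.
by move: A0 => /= ->; rewrite leNgt mub.
Qed.

Lemma separable_fair_coin : separable_measure fair_coin.
Proof.
(* The finite type [{set bool}] is countable, so this sequence lists every subset of [bool]; each
   [B] is matched exactly, with empty symmetric difference. *)
exists (fun n => if unpickle n is Some B then [set` (B : {set bool})] else set0).
split=> // B _ eps eps0; exists (pickle [set b | b \in B]%SET).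
rewrite pickleK (_ : [set` _] = B) ?setYK ?measure0//.
by apply/seteqP; split=> b /=; rewrite !inE.
Qed.

Context {E : normedModType R}.

Definition on_bool (p : E * E) (b : bool) : E := if b then p.1 else p.2.

(** Since no point is negligible, the essential supremum is the maximum over the two points, which
    is the product norm. *)
Lemma Bnorm_on_bool p : Bnorm fair_coin +oo (on_bool p) = `|p|%:E.
Proof.
rewrite Bnorm_infty prod_normE; apply/le_anti/andP; split.
  apply/ess_supP/nearW => -[]/=; by rewrite lee_fin le_max lexx ?orbT.
have /fair_coin_ae h := ess_sup_ge fair_coin (EFin \o (Num.norm \o on_bool p)).
by rewrite EFin_max ge_max (h true) (h false).
Qed.

Lemma on_bool_Linfty p : on_bool p \in Linfty_fun fair_coin (E := E).
Proof.
rewrite inE; split; last by rewrite Bnorm_on_bool ltry.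
(* A function on two points is already simple, so a constant sequence approximates it. *)
exists (fun=> on_bool p); split=> [_|x]; last exact: cvg_cst.
split=> //; rewrite -[range _]/(on_bool p @` setT); exact: finite_image.
Qed.

Definition Linfty_of_pair p : Linfty fair_coin E :=
  Linfty_class (MkLinftyFun (on_bool_Linfty p)).

Lemma Linfty_of_pair_linear : linear Linfty_of_pair.
Proof.
move=> a p q; rewrite -[X in _ = X + _]Linfty_piZ -Linfty_piD.
by apply/Linfty_eqP/nearW => -[].
Qed.

HB.instance Definition _ := GRing.isLinear.Build R _ _ _ Linfty_of_pair
  Linfty_of_pair_linear.

Lemma norm_Linfty_of_pair p : `|Linfty_of_pair p| = `|p|.
Proof. by rewrite [LHS]Linfty_normE Bnorm_on_bool. Qed.

Lemma Linfty_of_pair_inj : injective Linfty_of_pair.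
Proof.
by move=> p q /eqP; rewrite -subr_eq0 -raddfB -normr_eq0 norm_Linfty_of_pair
  normr_eq0 subr_eq0 => /eqP.
Qed.

(** The L1 norm is the mean of the norms of [p.1] and [p.2]; its double is their sum, which
    dominates their maximum. *)
Lemma norm_le_L1norm_Linfty_of_pair p :
  (`|Linfty_of_pair p|%:E <= 2%:E * L1norm (Linfty_of_pair p))%E.
Proof.
rewrite norm_Linfty_of_pair L1normE integral_bernoulli_prob//=.
rewrite -!EFinM lee_fin /unstable.onem onem_half prod_normE.
by rewrite -mulrDr mulrA mulfV// mul1r ge_max lerDl lerDr !normr_ge0.
Qed.

End two_points.

Theorem proposition2p2 (R : realType) (Y : completeNormedModType R) :
  infinite_dimensional Y -> ~ finitely_squarable Y -> ~ LB_discretization Y.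
Proof.
move=> _ nsq LB; apply: nsq.
have [f [_ fP]] := LB _ _ _ (@separable_fair_coin R).
(* The infimum of distortions is at most [f 2] but might not be attained; the extra 1 leaves room to
   pick an actual embedding. *)
exists (f 2 + 1) => Z fZ.
pose J : {linear (Y * Y)%type -> Linfty (@fair_coin R) Y} := @Linfty_of_pair R Y.
have fW : findim_subspace (J @` (Z `*` Z)).
  exact/findim_subspace_image/findim_subspace_setX.
have WZ : J @` (Z `*` Z) `<=` Linfty_in Z.
  (* The representative [on_bool p] takes only the values [p.1] and [p.2], both in [Z]. *)
  by move=> _ [p [Zp1 Zp2] <-]; eexists; [reflexivity|case].
have W1 w : (J @` (Z `*` Z)) w -> (`|w|%:E <= 2%:E * L1norm w)%E.
  by move=> [p _ <-]; exact: norm_le_L1norm_Linfty_of_pair.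
have := fP 2 (ler1n _ 2) Z fZ _ fW WZ W1.
have lt_f : ((f 2)%:E < (f 2 + 1)%:E)%E by rewrite lte_fin ltrDl.
move=> /le_lt_trans/(_ lt_f)/ereal_inf_lt[_ [S [linS injS] <-] /ltW dS].
have JP p : (Z `*` Z) p -> J p \in J @` (Z `*` Z) by rewrite inE; exists p.
exists (S \o J).
  split=> [a p q|p q]; rewrite !inE => Zp Zq /=.
    by rewrite linearP linS // JP.
  by move=> /injS => h; apply/Linfty_of_pair_inj/h; rewrite JP.
rewrite distortion_comp_isometry//.
  exact: Linfty_of_pair_inj.
exact: norm_Linfty_of_pair.
Qed.
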